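(* Assume that Assumptions A0 (solvability), A1 (stability), A2 (noncharacteristic discrete boundary, weak form) and A3 (technical restriction) stated in the context are satisfied. Then, for every $(\Delta t,\Delta x)\in\boldsymbol{\Delta}$, there exists a sequence $(\boldsymbol{\Pi}_n)_{n\in\mathbb N}$ of bounded operators on $\ell^2(\mathbb Z^{d-1};\mathbb C^{p_1+r_1})$ that satisfies $$\forall\,\delta>0,\quad \sum_{n\in\mathbb N}\frac{1}{(1+\delta)^n}\,\|\boldsymbol{\Pi}_n\|_{\mathcal B(\ell^2(\mathbb Z^{d-1}))}<+\infty,$$ $$\forall\, n\in\mathbb N,\quad \boldsymbol{\Pi}_n=\sum_{m=0}^n\boldsymbol{\Pi}_m\,\boldsymbol{\Pi}_{n-m},$$ and such that for all initial data $f^0,\dots,f^s\in\ell^2(\mathbb Z^d)$ verifying $$\forall\,\sigma=0,\dots,s,\quad\forall\, j_1\le p_1,\quad f^\sigma_{(j_1,\cdot)}=0,$$ the solution $(u^n)_{n\in\mathbb N}$ to the Cauchy problem $$\sum_{\sigma=0}^{s+1}Q_\sigma\,u^{n+\sigma}=0\ \ (n\ge0),\qquad (u^0,\dots,u^s)=(f^0,\dots,f^s)$$ on $\mathbb Z^d$ satisfies $$\forall\, n\in\mathbb N,\quad\forall\, j_1\le 0,\quad \sum_{m=0}^n\boldsymbol{\Pi}_{n-m}\begin{pmatrix}u^m_{(j_1+p_1,\cdot)}\\ \vdots\\ u^m_{(j_1+1-r_1,\cdot)}\end{pmatrix}=0 .$$ When the scheme is explicit (case (i) of Assumption A3), the operator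 $\boldsymbol{\Pi}_0$ is given by $$\boldsymbol{\Pi}_0=\begin{pmatrix}0&0\\0&I_{r_1}\end{pmatrix}.$$
   Context: Notation. $\mathcal U=\{\zeta\in\mathbb C:|\zeta|>1\}$, $\mathbb S^1=\{|\zeta|=1\}$. $d\ge1$ and $s\in\mathbb N$ are fixed integers ($\mathbb N\ni0$), and $r=(r_1,\dots,r_d)$, $p=(p_1,\dots,p_d)\in\mathbb N^d$ are fixed. The symbol $\sum_{\ell=-r}^{p}$ means the sum over all $\ell\in\mathbb Z^d$ with $-r_k\le\ell_k\le p_k$ for each $k$. We write $j=(j_1,j')\in\mathbb Z\times\mathbb Z^{d-1}$, $\ell=(\ell_1,\ell')$, $r'=(r_2,\dots,r_d)$, $p'=(p_2,\dots,p_d)$; $\sum_{\ell'=-r'}^{p'}$ is understood similarly. For a sequence $u$ on $\mathbb Z^d$, $u_{(j_1,\cdot)}$ denotes the sequence $j'\mapsto u_{(j_1,j')}$ on $\mathbb Z^{d-1}$. In the case $d=1$, $\ell^2(\mathbb Z^{d-1};\mathbb C^k)$ is $\mathbb C^k$ and the variable $\boldsymbol\eta\in\mathbb R^{d-1}$ is absent. $I_{r_1}$ is the identity of size $r_1$ and the blocks of $\boldsymbol\Pi_0$ correspond to $\mathbb C^{p_1+r_1}=\mathbb C^{p_1}\times\mathbb C^{r_1}$. Scheme. $\boldsymbol\Delta\subset(0,+\infty)^{d+1}$ is a set of discretization parameters $(\Delta t,\Delta x)=(\Delta t,\Delta x_1,\dots,\Delta x_d)$. The coefficients $a_{\ell,\sigma}(\Delta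 t,\Delta x)\in\mathbb C$ are defined on $\boldsymbol\Delta$, and for $\sigma=0,\dots,s+1$ $$Q_\sigma=\sum_{\ell=-r}^p a_{\ell,\sigma}(\Delta t,\Delta x)\,\mathbf S^\ell,\qquad(\mathbf S^\ell u)_j=u_{j+\ell},$$ acting on complex scalar sequences. The symbols are $\widehat{Q_\sigma}(\boldsymbol\kappa)=\sum_{\ell=-r}^pa_{\ell,\sigma}(\Delta t,\Delta x)\,\boldsymbol\kappa^\ell$, $\boldsymbol\kappa^\ell=\kappa_1^{\ell_1}\cdots\kappa_d^{\ell_d}$, for $\boldsymbol\kappa\in(\mathbb C\setminus\{0\})^d$. The Cauchy problem on $\mathbb Z^d$ is $\sum_{\sigma=0}^{s+1}Q_\sigma u^{n+\sigma}=0$ for $n\ge0$ with $(u^0,\dots,u^s)=(f^0,\dots,f^s)\in\ell^2(\mathbb Z^d)^{s+1}$ and $u^n\in\ell^2(\mathbb Z^d)$. Let $|||u|||_{-\infty,+\infty}^2=\big(\prod_{k=1}^d\Delta x_k\big)\sum_{j\in\mathbb Z^d}|u_j|^2$. For $\ell_1=-r_1,\dots,p_1$, $z\in\mathbb C$, $\boldsymbol\eta\in\mathbb R^{d-1}$, set $$a_{\ell_1}(z,\boldsymbol\eta)=\sum_{\sigma=0}^{s+1}z^\sigma\sum_{\ell'=-r'}^{p'}a_{(\ell_1,\ell'),\sigma}(\Delta t,\Delta x)\,e^{i\ell'\cdot\boldsymbol\eta}.$$ Assumptions (required for all $(\Delta t,\Delta x)\in\boldsymbol\Delta$). A0 (solvability):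 $Q_{s+1}$ is an isomorphism on $\ell^2(\mathbb Z^d)$, equivalently $\widehat{Q_{s+1}}(\boldsymbol\kappa)\ne0$ for all $\boldsymbol\kappa\in(\mathbb S^1)^d$; moreover for all $\boldsymbol\eta=(\eta_2,\dots,\eta_d)\in\mathbb R^{d-1}$, $$\frac1{2i\pi}\int_{\mathbb S^1}\frac{\partial_{\kappa_1}\widehat{Q_{s+1}}(\kappa_1,e^{i\eta_2},\dots,e^{i\eta_d})}{\widehat{Q_{s+1}}(\kappa_1,e^{i\eta_2},\dots,e^{i\eta_d})}\,d\kappa_1=0.$$ A1 (stability): there is a constant $C(\Delta t,\Delta x)>0$ such that for all $f^0,\dots,f^s\in\ell^2(\mathbb Z^d)$ the solution of the Cauchy problem satisfies $\sup_{n\in\mathbb N}|||u^n|||_{-\infty,+\infty}^2\le C(\Delta t,\Delta x)\sum_{\sigma=0}^s|||f^\sigma|||_{-\infty,+\infty}^2$. A2 (noncharacteristic discrete boundary, weak form): $a_{-r_1}$ and $a_{p_1}$ do not vanish on $\mathcal U\times\mathbb R^{d-1}$. A3 (technical restriction): one of the following holds. (i) $Q_{s+1}=I$ (explicit scheme), and for all $\boldsymbol\eta\in\mathbb R^{d-1}$: $\sum_{\ell'=-r'}^{p'}a_{(-r_1,\ell'),s}(\Delta t,\Delta x)e^{i\ell'\cdot\boldsymbol\eta}\ne0$ if $r_1>0$, and $\sum_{\ell'=-r'}^{p'}a_{(p_1,\ell'),s}(\Delta t,\Delta x)e^{i\ell'\cdot\boldsymbol\eta}\ne0$ if $p_1>0$.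 (ii) $Q_{s+1}\neq I$ (implicit scheme), and for all $\boldsymbol\eta\in\mathbb R^{d-1}$: $\sum_{\ell'=-r'}^{p'}a_{(-r_1,\ell'),s+1}(\Delta t,\Delta x)e^{i\ell'\cdot\boldsymbol\eta}\ne0$ and $\sum_{\ell'=-r'}^{p'}a_{(p_1,\ell'),s+1}(\Delta t,\Delta x)e^{i\ell'\cdot\boldsymbol\eta}\ne0$. *)

(* Defs.v *)
(* Mathematical Components with MathComp-Analysis and real-closed. *)
From HB Require Import structures.
From mathcomp Require Import all_boot all_order all_algebra.
From mathcomp Require Import all_classical all_reals all_analysis.
From mathcomp Require Import complex.

Set Implicit Arguments.
Unset Strict Implicit.
Unset Printing Implicit Defensive.

Import Order.TTheory GRing.Theory Num.Theory numFieldNormedType.Exports.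

Local Open Scope classical_set_scope.
Local Open Scope ring_scope.
Local Open Scope complex_scope.

(* Z^d *)
Definition zvec (d : nat) := {ffun 'I_d -> int}.

(* In j = (j_1, j'), the normal coordinate j_1 sits at index ord0. *)
Definition vcons (T : Type) (m : nat) (x : T) (v : 'I_m -> T) : 'I_m.+1 -> T :=
  fun k => if unlift ord0 k is Some k' then v k' else x.

Definition vtail (T : Type) (m : nat) (v : 'I_m.+1 -> T) : 'I_m -> T :=
  fun k => v (lift ord0 k).

Definition zcons (m : nat) (j1 : int) (j' : zvec m) : zvec m.+1 :=
  [ffun k => vcons j1 j' k].

(* The multi-indices l with -r <= l <= p; this set is finite, so that the
   finitely supported sums below are the sums over all its elements. *)
Definition box (d : nat) (r p : 'I_d -> nat) : set (zvec d) :=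
  [set l | forall k, - (r k)%:Z <= l k <= (p k)%:Z].

Section SquareSummable.
Context {R : realType} {I : choiceType} {V : lmodType R[i]}.

(* N is the norm on the space of values. *)
Variable N : V -> R.

Definition l2normsq (u : I -> V) : \bar R :=
  (\esum_(j in [set: I]) (N (u j) ^+ 2)%:E)%E.

Definition l2norm (u : I -> V) : \bar R := (l2normsq u `^ 2^-1)%E.

Definition l2 : set (I -> V) := [set u | (l2normsq u < +oo)%E].

(* Operators on l2 are represented by maps on all families, of which only the
   restriction to l2 is meaningful. *)
Definition l2opnorm (T : (I -> V) -> (I -> V)) : \bar R :=
  ereal_sup [set l2norm (T w) | w in [set w | (l2norm w <= 1)%E]].

Definition l2bounded (T : (I -> V) -> (I -> V)) : Prop :=
  [/\ forall w, l2 w -> l2 (T w),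
      forall (c : R[i]) v w, l2 v -> l2 w -> T (c *: v + w) = c *: T v + T w
    & (l2opnorm T < +oo)%E].

Definition l2iso (T : (I -> V) -> (I -> V)) : Prop :=
  l2bounded T /\
  exists2 S, l2bounded S & forall w, l2 w -> S (T w) = w /\ T (S w) = w.

End SquareSummable.

Section Complex.
Context {R : realType}.

Definition modc (z : R[i]) : R := Normc.normc z.

Definition euclnorm (k : nat) (v : 'cV[R[i]]_k) : R :=
  Num.sqrt (\sum_(i < k) modc (v i 0) ^+ 2).

Definition expi (t : R) : R[i] := cos t +i* sin t.

Definition circle_integral (g : R[i] -> R[i]) : R[i] :=
  let h t := g (expi t) * ('i * expi t) in
  Complex
    (\int[@lebesgue_measure R]_(t in `[0, 2 * pi]) complex.Re (h t))
    (\int[@lebesgue_measure R]_(t in `[0, 2 * pi]) complex.Im (h t)).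

End Complex.

Arguments euclnorm {R k} v.

Section Scheme.
Context {R : realType} {d' : nat}.
Local Notation d := d'.+1.

Variables (s : nat) (r p : 'I_d -> nat).

(* The coefficients a_{l,sigma} for fixed discretization parameters; only
   sigma <= s + 1 and l in the box matter. *)
Variable a : nat -> zvec d -> R[i].

Definition Q (sigma : nat) (u : zvec d -> R[i]) : zvec d -> R[i] :=
  fun j => \sum_(l \in box r p) a sigma l * u (j + l).

Definition Qhat (sigma : nat) (kappa : 'I_d -> R[i]) : R[i] :=
  \sum_(l \in box r p) a sigma l * \prod_(k < d) kappa k ^ l k.

(* sum over l' of a_{(l1,l'),sigma} e^{i l'.eta} *)
Definition tangential_symbol (sigma : nat) (l1 : int) (eta : 'I_d' -> R)
    : R[i] :=
  \sum_(l' \in box (vtail r) (vtail p))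
    a sigma (zcons l1 l') * expi (\sum_(k < d') (l' k)%:~R * eta k).

(* a_{l1}(z, eta) *)
Definition normal_coef (l1 : int) (z : R[i]) (eta : 'I_d' -> R) : R[i] :=
  \sum_(sigma < s.+2) z ^+ sigma * tangential_symbol sigma l1 eta.

Definition cauchy_solution (f : 'I_s.+1 -> zvec d -> R[i])
    (u : nat -> zvec d -> R[i]) : Prop :=
  [/\ forall n, l2 modc (u n),
      forall n, \sum_(sigma < s.+2) Q sigma (u (n + sigma)%N) = 0
    & forall sigma : 'I_s.+1, u sigma = f sigma].

(* |||u|||_{-oo,+oo}^2 *)
Definition tnormsq (Dx : 'I_d -> R) (u : zvec d -> R[i]) : \bar R :=
  ((\prod_(k < d) Dx k)%:E * l2normsq modc u)%E.

Definition solvability : Prop :=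
  l2iso modc (Q s.+1) /\
  forall eta : 'I_d' -> R,
    let q k1 := Qhat s.+1 (vcons k1 (fun k => expi (eta k))) in
    (2 * 'i * pi%:C)^-1 *
      circle_integral (fun k1 => @derive1 R[i] R[i]^o q k1 / q k1) = 0.

Definition stability (Dx : 'I_d -> R) : Prop :=
  exists2 C : R, 0 < C &
    forall f : 'I_s.+1 -> zvec d -> R[i], (forall sigma, l2 modc (f sigma)) ->
    forall u, cauchy_solution f u ->
      (ereal_sup [set tnormsq Dx (u n) | n in [set: nat]] <=
         C%:E * \sum_(sigma < s.+1) tnormsq Dx (f sigma))%E.

Definition noncharacteristic : Prop :=
  forall (z : R[i]) (eta : 'I_d' -> R), 1 < modc z ->
    normal_coef (- (r ord0)%:Z) z eta != 0 /\
    normal_coef (p ord0)%:Z z eta != 0.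

Definition explicit_scheme : Prop := Q s.+1 = id.

Definition technical_explicit : Prop :=
  explicit_scheme /\
  forall eta : 'I_d' -> R,
    ((0 < r ord0)%N -> tangential_symbol s (- (r ord0)%:Z) eta != 0) /\
    ((0 < p ord0)%N -> tangential_symbol s (p ord0)%:Z eta != 0).

Definition technical_implicit : Prop :=
  ~ explicit_scheme /\
  forall eta : 'I_d' -> R,
    tangential_symbol s.+1 (- (r ord0)%:Z) eta != 0 /\
    tangential_symbol s.+1 (p ord0)%:Z eta != 0.

Definition technical_restriction : Prop :=
  technical_explicit \/ technical_implicit.

(* The column (u_{(j1+p1,.)}, ..., u_{(j1+1-r1,.)}), of size p1 + r1, listed by
   decreasing first index. *)
Definition boundary_vector (u : zvec d -> R[i]) (j1 : int)
    : zvec d' -> 'cV[R[i]]_(p ord0 + r ord0) :=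
  fun j' => \col_(i < p ord0 + r ord0)
    u (zcons (j1 + (p ord0)%:Z - (i : nat)%:Z) j').

End Scheme.

(* Main.v *)
Require Import Defs.
From HB Require Import structures.
From mathcomp Require Import all_boot all_order all_algebra.
From mathcomp Require Import all_classical all_reals all_analysis.
From mathcomp Require Import complex zify lra.

Set Implicit Arguments.
Unset Strict Implicit.
Unset Printing Implicit Defensive.

Import Order.TTheory GRing.Theory Num.Theory numFieldNormedType.Exports.

Local Open Scope classical_set_scope.
Local Open Scope ring_scope.
Local Open Scope complex_scope.

(** The operators [Pi_n] are the Taylor coefficients in [1/z] of a discrete
    Calderon projector.

    With [U(z) = sum_n z^-n u^n], the scheme becomes the equation [A(z) U = 0]
    with [A(z) = sum_t z^-t A_t] and [A_t = Q_{s+1-t}].  The leading coefficient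
    [A_0 = Q_{s+1}] is invertible on l2, so [A(z)] has an inverse [G(z)] as a
    formal power series in [1/z] with coefficients that act on l2.  Write [trace]
    for the restriction to the strip [-r_1 < j_1 <= p_1], which has the width of
    the stencil, [ext] for the extension by zero from this strip, and [1_-] for
    the cutoff to [j_1 <= 0].  The projector is
      [Pi(z) = trace G(z) 1_- A(z) ext].

    A stencil centred at [j_1 <= 0] reaches no further than [p_1] to the right,
    and one centred at [j_1 > 0] reaches only indices [> -r_1].  Hence two
    sequences with the same values on the strip can be glued there, and:
    - if [A(z) v = 0] at every [j_1 > 0], then [v 1_{j_1 > -r_1}] solves
      [A(z) x = 1_- A(z) ext (trace v)], so that [Pi(z) (trace v) = trace v]
      (lemma [calderon_fix]);
    - if [A(z) v = 0] at every [j_1 <= 0], then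
      [ext (trace v) - v 1_{j_1 <= p_1}] solves the same equation and has trace
      zero, so that [Pi(z) (trace v) = 0] (lemma [calderon_kill]).
    The range of [Pi(z)] consists of traces of the first kind, whence
    [Pi(z)^2 = Pi(z)], and the coefficient of [z^-n] in this identity is the
    convolution formula.  A solution of the Cauchy problem with data supported in
    [j_1 > p_1] is of the second kind, and so are its translates by [j_1 <= 0]:
    this is the transparent boundary condition.

    The bound on [Pi_n] comes from stability.  Up to a delay of [s] steps, the
    sequence [G_n g] is the solution of the Cauchy problem with data
    [(0, .., 0, Q_{s+1}^-1 g)], so that [G_n] is bounded uniformly in [n] (lemma
    [green_dominated]), and only the operators [G_{n-t}] with [t <= s + 1] enter
    [Pi_n].  The norms of the [Pi_n] are thus uniformly bounded, and the weighted
    series is dominated by a geometric one.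

    Power series in [1/z] are represented by their sequences of coefficients, and
    products of series by convolutions. *)

(** * Square-summable families *)

Section SquareSums.
Context {R : realType} {I : choiceType}.
Implicit Types (u v : I -> R[i]).

Lemma l2normsq_ge0 (V : lmodType R[i]) (N : V -> R) (u : I -> V) :
  (0 <= l2normsq N u)%E.
Proof. by apply: esum_ge0 => j _; rewrite lee_fin sqr_ge0. Qed.

Lemma modc_ge0 (z : R[i]) : 0 <= modc z.
Proof. by case: z => x y; exact: sqrtr_ge0. Qed.

Lemma modcM (z w : R[i]) : modc (z * w) = modc z * modc w.
Proof. exact: Normc.normcM. Qed.

Lemma modc0 : modc (0 : R[i]) = 0.
Proof. exact: Normc.normc0. Qed.

Lemma modc_real (x : R) : 0 <= x -> modc x%:C = x.
Proof. by move=> x0; rewrite /modc/= expr0n addr0 sqrtr_sqr ger0_norm. Qed.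

Lemma modcD_sqr (z w : R[i]) :
  modc (z + w) ^+ 2 <= 2 * modc z ^+ 2 + 2 * modc w ^+ 2.
Proof.
have le_zw : modc (z + w) ^+ 2 <= (modc z + modc w) ^+ 2.
  by rewrite ler_sqr ?nnegrE ?addr_ge0 ?modc_ge0//; exact: le_normcD.
by apply: le_trans le_zw _; have := sqr_ge0 (modc z - modc w); nra.
Qed.

Lemma l2normsq_le u v : (forall j, modc (u j) <= modc (v j)) ->
  (l2normsq modc u <= l2normsq modc v)%E.
Proof.
move=> le_uv; apply: le_esum => j _.
by rewrite lee_fin ler_sqr ?nnegrE ?modc_ge0.
Qed.

Lemma l2normsq0 : l2normsq modc (0 : I -> R[i]) = 0%E.
Proof. by apply: esum1 => j _; rewrite modc0 expr0n. Qed.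

Lemma esum_scale_le (c : R) (f : I -> \bar R) : 0 <= c ->
  (forall j, 0 <= f j)%E ->
  (\esum_(j in setT) (c%:E * f j) <= c%:E * \esum_(j in setT) f j)%E.
Proof.
move=> c0 f0; apply: ge_ereal_sup => _ [F [finF _] <-].
rewrite -ge0_mule_fsumr//; apply: lee_wpmul2l; first by rewrite lee_fin.
by apply: ereal_sup_ubound; exists F.
Qed.

Lemma l2normsqZ_le c u :
  (l2normsq modc (c *: u)%R <= (modc c ^+ 2)%R%:E * l2normsq modc u)%E.
Proof.
have u_pos j : (0 <= (modc (u j) ^+ 2)%:E)%E by rewrite lee_fin sqr_ge0.
apply: le_trans (esum_scale_le (sqr_ge0 (modc c)) u_pos).
by apply: le_esum => j _; rewrite -EFinM -exprMn -modcM.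
Qed.

Lemma l2normsqD_le u v : (l2normsq modc (u + v)%R <=
  2%:E * l2normsq modc u + 2%:E * l2normsq modc v)%E.
Proof.
have pos (w : I -> R[i]) j : (0 <= (modc (w j) ^+ 2)%:E)%E.
  by rewrite lee_fin sqr_ge0.
apply: (@le_trans _ _ (\esum_(j in setT)
    (2%:E * (modc (u j) ^+ 2)%:E + 2%:E * (modc (v j) ^+ 2)%:E))%E).
  by apply: le_esum => j _; rewrite -!EFinM -EFinD lee_fin modcD_sqr.
rewrite esumD => [|j _|j _]; try by rewrite mule_ge0.
by apply: leeD; exact: esum_scale_le.
Qed.

Lemma l2_scale_add c u v : l2 modc u -> l2 modc v -> l2 modc (c *: u + v).
Proof.
rewrite /l2/= => u2 v2; apply: le_lt_trans (l2normsqD_le _ _) _.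
rewrite lte_add_pinfty// lte_mul_pinfty//.
apply: le_lt_trans (l2normsqZ_le _ _) _.
by rewrite lte_mul_pinfty// lee_fin sqr_ge0.
Qed.

Lemma l2_zero : l2 modc (0 : I -> R[i]).
Proof. by rewrite /l2/= l2normsq0. Qed.

Lemma l2normsq_eq0 u : l2normsq modc u = 0%E -> u = 0.
Proof.
move=> u0; apply/funext => j; apply: Normc.eq0_normc; apply/eqP.
rewrite -sqrf_eq0 eq_le sqr_ge0 andbT -lee_fin.
change (((modc (u j) ^+ 2)%:E <= 0)%E); rewrite -u0.
rewrite -[leLHS](@esum_set1 R I j (fun k => (modc (u k) ^+ 2)%:E));
  last by rewrite lee_fin sqr_ge0.
rewrite [leLHS]esum_mkcond; apply: le_esum => k _.
by case: ifP; rewrite // lee_fin sqr_ge0.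
Qed.

Lemma l2normsq_sum_le n (f : 'I_n -> I -> R[i]) :
  (l2normsq modc (\sum_(i < n) f i)%R <=
   (2 ^+ n)%R%:E * \sum_(i < n) l2normsq modc (f i))%E.
Proof.
elim: n f => [|n IH] f; first by rewrite !big_ord0 l2normsq0 mule0.
rewrite !big_ord_recl ge0_muleDr ?l2normsq_ge0//; last first.
  by apply: sume_ge0 => i _; exact: l2normsq_ge0.
apply: le_trans (l2normsqD_le _ _) _; rewrite leeD//.
  rewrite lee_wpmul2r ?l2normsq_ge0// lee_fin exprS.
  by rewrite ler_peMr// exprn_ege1// ler1n.
by rewrite exprS EFinM -muleA lee_wpmul2l ?IH// lee_fin.
Qed.

End SquareSums.

Section OperatorNorm.
Context {R : realType} {I : choiceType}.

(** A bound on squared norms: finite sums of operators are then controlled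
    without taking square roots of extended reals. *)
Definition l2dominated (V : lmodType R[i]) (N : V -> R)
    (T : (I -> V) -> (I -> V)) (M : R) : Prop :=
  forall u, l2 N u -> (l2normsq N (T u) <= M%:E * l2normsq N u)%E.

Lemma l2dominated_l2 (V : lmodType R[i]) (N : V -> R)
    (T : (I -> V) -> (I -> V)) (M : R) : 0 <= M ->
  l2dominated N T M -> forall u, l2 N u -> l2 N (T u).
Proof.
move=> M0 TM u u2; apply: le_lt_trans (TM u u2) _.
by rewrite lte_mul_pinfty// lee_fin.
Qed.

Lemma l2norm_leE (V : lmodType R[i]) (N : V -> R) (u : I -> V) (c : R) :
  0 <= c -> (l2norm N u <= c%:E)%E = (l2normsq N u <= (c ^+ 2)%:E)%E.
Proof.
move=> c0; rewrite /l2norm; have := l2normsq_ge0 N u.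
case: (l2normsq N u) => [x x0|_|//]; last first.
  by rewrite poweRyr ?invr_eq0// !leye_eq.
rewrite poweR_EFin !lee_fin; rewrite lee_fin in x0.
by rewrite powR12_sqrt// -[in RHS](sqr_sqrtr x0) ler_sqr ?nnegrE ?sqrtr_ge0.
Qed.

Lemma l2opnorm_ge0 (V : lmodType R[i]) (N : V -> R)
    (T : (I -> V) -> (I -> V)) : N 0 = 0 -> (0 <= l2opnorm N T)%E.
Proof.
move=> N0; apply: (@le_trans _ _ (l2norm N (T 0))); first exact: poweR_ge0.
apply: ereal_sup_ubound; exists 0 => //=; rewrite l2norm_leE// expr1n.
by rewrite /l2normsq esum1// => j _; rewrite N0 expr0n.
Qed.

Lemma l2opnorm_le (V : lmodType R[i]) (N : V -> R)
    (T : (I -> V) -> (I -> V)) (M : R) : 0 <= M ->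
  l2dominated N T M -> (l2opnorm N T <= (Num.sqrt M)%:E)%E.
Proof.
move=> M0 TM; apply: ge_ereal_sup => _ [u /= + <-].
rewrite !l2norm_leE ?sqrtr_ge0// expr1n sqr_sqrtr// => u1.
have u2 : l2 N u by apply: le_lt_trans u1 _; rewrite ltry.
by apply: le_trans (TM u u2) _; rewrite -[leRHS]mule1 lee_wpmul2l.
Qed.

(** The operator norm only concerns the unit ball; other families are rescaled to
    norm 1, except those of norm zero, which vanish. *)
Lemma l2bounded_dominated (T : (I -> R[i]) -> (I -> R[i])) :
  l2bounded modc T -> exists2 M : R, 0 <= M & l2dominated modc T M.
Proof.
case=> T2 Tlin Tfin.
have T0 : T 0 = 0.
  have := Tlin 1 0 0 l2_zero l2_zero; rewrite !scale1r addr0 => /esym/eqP.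
  by rewrite -subr_eq0 addrK => /eqP.
have TZ c u : l2 modc u -> T (c *: u) = c *: T u.
  by move=> u2; rewrite -[c *: u]addr0 Tlin// ?T0 ?addr0//; exact: l2_zero.
have norm_le u : l2 modc u -> (l2normsq modc u <= 1)%E ->
    (l2norm modc (T u) <= l2opnorm modc T)%E.
  move=> u2 u1; apply: ereal_sup_ubound; exists u => //=.
  by rewrite l2norm_leE// expr1n.
have K0 : (0 <= l2opnorm modc T)%E by exact/l2opnorm_ge0/modc0.
have [K opK] : exists K, l2opnorm modc T = K%:E.
  by exists (fine (l2opnorm modc T)); rewrite fineK// ge0_fin_numE.
rewrite opK lee_fin in K0 norm_le.
exists (K ^+ 2) => [|u u2]; first exact: sqr_ge0.
have [u0|un0] := eqVneq (l2normsq modc u) 0%E.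
  by rewrite (l2normsq_eq0 u0) T0 l2normsq0 mule0.
have := u2; have := l2normsq_ge0 modc u; rewrite /l2/=.
case E : (l2normsq modc u) => [x| |]// x0 _.
have {x0} x_gt0 : 0 < x by rewrite -lte_fin -E lt_def un0 E.
pose c := Num.sqrt x; have c_gt0 : 0 < c by rewrite sqrtr_gt0.
have cC : (c%:C : R[i]) != 0 by rewrite eq_complex/= negb_and gt_eqF.
have mod_c : modc (c%:C : R[i])^-1 ^+ 2 = x^-1.
  rewrite /modc Normc.normcV -/(modc _) modc_real ?ltW//.
  by rewrite exprVn sqr_sqrtr ?ltW.
have su_le1 : (l2normsq modc ((c%:C)^-1 *: u) <= 1)%E.
  by apply: le_trans (l2normsqZ_le _ _) _; rewrite mod_c E -EFinM mulVf ?gt_eqF.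
have su2 : l2 modc ((c%:C)^-1 *: u).
  by apply: le_lt_trans su_le1 _; rewrite ltry.
have := norm_le _ su2 su_le1; rewrite l2norm_leE// => Tsu_le.
rewrite -[u in T u](scalerKV cC) TZ// (le_trans (l2normsqZ_le _ _))//.
rewrite modc_real ?(ltW c_gt0)// (sqr_sqrtr (ltW x_gt0)) muleC.
by rewrite lee_wpmul2r// lee_fin ltW.
Qed.

End OperatorNorm.

(** * Formal power series of operators *)

(** The rearrangement behind the associativity of convolution. *)
Lemma sum_triangle (X : nmodType) (F : nat -> nat -> nat -> X) n :
  \sum_(i < n.+1) \sum_(j < (n - i).+1) F i j (n - i - j)%N =
  \sum_(k < n.+1) \sum_(i < k.+1) F i (k - i)%N (n - k)%N.
Proof.
have inner (i : 'I_n.+1) : \sum_(j < (n - i).+1) F i j (n - i - j)%N =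
    \sum_(k < n.+1 | (i <= k)%N) F i (k - i)%N (n - k)%N.
  rewrite -[RHS](big_mkord (fun k => i <= k)%N
                           (fun k => F i (k - i)%N (n - k)%N)).
  have le_in : (i <= n.+1)%N by rewrite ltnW.
  rewrite (big_cat_nat _ (n := i))//= [X in _ = X + _]big_nat_cond.
  rewrite [X in _ = X + _]big_pred0 => [|k]; last first.
    by apply/negP; lia.
  rewrite Monoid.simpm -[X in index_iota X]add0n big_addn subSn -1?ltnS//.
  rewrite big_mkord; apply: eq_big => [k|k _]; first by rewrite leq_addl.
  by rewrite addnK subnDA [(n - k - _)%N]subnAC.
under eq_bigr do rewrite inner.
rewrite (exchange_big_dep xpredT)//=; apply: eq_bigr => k _.
rewrite -(big_mkord (fun i => i <= k)%N (fun i => F i (k - i)%N (n - k)%N)).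
rewrite (big_cat_nat _ (n := k.+1))//= [X in _ + X]big_nat_cond.
rewrite [X in _ + X]big_pred0 => [|i]; last by apply/negP; lia.
rewrite Monoid.simpm big_mkord; apply: eq_bigl => i.
by rewrite -ltnS ltn_ord.
Qed.

(** The operators [A t] act on all of [X], but the inverse [S] of the leading
    coefficient is only meaningful on the subspace [H], so that membership in [H]
    has to be tracked throughout. *)
Section Convolution.
Variables (K : nzRingType) (X : lmodType K) (H : set X).
Hypothesis H0 : H 0.
Hypothesis Hlin : forall c u v, H u -> H v -> H (c *: u + v).

Lemma subspaceZ c u : H u -> H (c *: u).
Proof. by move=> Hu; rewrite -[_ *: _]addr0; exact: Hlin. Qed.

Lemma subspaceD u v : H u -> H v -> H (u + v).
Proof. by move=> Hu Hv; rewrite -[u]scale1r; exact: Hlin. Qed.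

Lemma subspaceN u : H u -> H (- u).
Proof. by rewrite -scaleN1r; exact: subspaceZ. Qed.

Lemma subspaceB u v : H u -> H v -> H (u - v).
Proof. by move=> Hu /subspaceN; exact: subspaceD. Qed.

Lemma subspace_sum n (f : 'I_n -> X) :
  (forall i, H (f i)) -> H (\sum_(i < n) f i).
Proof. by move=> Hf; elim/big_ind : _ => //; exact: subspaceD. Qed.

Definition convolve (F : nat -> X -> X) (v : nat -> X) (n : nat) : X :=
  \sum_(t < n.+1) F t (v (n - t)%N).

Variable A : nat -> {linear X -> X}.
Hypothesis HA : forall t u, H u -> H (A t u).

Variable S : X -> X.
Hypothesis HS : forall u, H u -> H (S u).
Hypothesis SK : forall u, H u -> S (A 0%N u) = u.
Hypothesis AK : forall u, H u -> A 0%N (S u) = u.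

Lemma convolve_is_linear c u v n :
  convolve A (fun k => c *: u k + v k) n =
  c *: convolve A u n + convolve A v n.
Proof.
rewrite /convolve scaler_sumr -big_split/=.
by apply: eq_bigr => t _; rewrite linearP.
Qed.

Lemma convolveB u v n :
  convolve A (fun k => u k - v k) n = convolve A u n - convolve A v n.
Proof.
rewrite /convolve -sumrB.
by apply: eq_bigr => t _; rewrite linearB.
Qed.

Lemma subspace_convolve v : (forall n, H (v n)) -> forall n, H (convolve A v n).
Proof. by move=> Hv n; apply: subspace_sum => t; exact: HA. Qed.

Lemma convolve_eq0 v : (forall n, H (v n)) ->
  (forall n, convolve A v n = 0) -> forall n, v n = 0.
Proof.
move=> Hv Av0 n; elim/ltn_ind : n => n IH.
have := Av0 n; rewrite /convolve big_ord_recl subn0 big1 ?addr0 => [A0v|t _].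
  by rewrite -(SK (Hv n)) A0v; have := SK H0; rewrite linear0.
rewrite IH ?linear0// lift0.
case: n t {IH} => [[]//|n t]; by rewrite subSS ltnS leq_subr.
Qed.

Lemma convolve_inj u v : (forall n, H (u n)) -> (forall n, H (v n)) ->
  (forall n, convolve A u n = convolve A v n) -> forall n, u n = v n.
Proof.
move=> Hu Hv Auv n; apply/eqP; rewrite -subr_eq0; apply/eqP.
apply: (@convolve_eq0 (fun k => u k - v k)) => k; first exact: subspaceB.
by rewrite convolveB Auv subrr.
Qed.

(** The coefficients of the inverse series, applied to [g]: they are obtained by
    solving [A_0 G_{n+1} g = - sum_{t <= n} A_{t+1} G_{n-t} g].  The recursion
    reaches back to [G_0 g], so the whole history is kept. *)
Fixpoint green_upto (g : X) (n : nat) : nat -> X :=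
  if n isn't m.+1 then fun=> S g else
  let b := green_upto g m in
  fun k => if (k <= m)%N then b k
           else S (- \sum_(t < m.+1) A t.+1 (b (m - t)%N)).

Definition green n g := green_upto g n n.

Lemma green_upto_stable g n k : (k <= n)%N -> green_upto g n k = green k g.
Proof.
elim: n => [|n IH] in k *; first by rewrite leqn0 => /eqP->.
by rewrite leq_eqVlt ltnS => /predU1P[->//|lekn] /=; rewrite lekn IH.
Qed.

Lemma greenS n g :
  green n.+1 g = S (- \sum_(t < n.+1) A t.+1 (green (n - t) g)).
Proof.
rewrite [LHS]/green/= ltnn; congr (S (- _)); apply: eq_bigr => t _.
by rewrite green_upto_stable// leq_subr.
Qed.

Lemma subspace_green n g : H g -> H (green n g).
Proof.
move=> Hg; elim/ltn_ind : n => -[|n] IH; first exact: HS.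
rewrite greenS; apply/HS/subspaceN/subspace_sum => t.
by apply/HA/IH; rewrite ltnS leq_subr.
Qed.

(** In terms of power series, [A(z) G(z) = 1]. *)
Lemma convolve_green g n : H g ->
  convolve A (green^~ g) n = if n == 0%N then g else 0.
Proof.
move=> Hg; rewrite /convolve big_ord_recl subn0.
case: n => [|n]; first by rewrite big_ord0 addr0 AK.
rewrite greenS AK ?addNr//; apply/subspaceN/subspace_sum => t.
exact/HA/subspace_green.
Qed.

(** By uniqueness: both sides have the same convolution with [A]. *)
Lemma green_is_linear n c g h : H g -> H h ->
  green n (c *: g + h) = c *: green n g + green n h.
Proof.
move=> Hg Hh; pose v k := c *: green k g + green k h.
apply: (@convolve_inj (green^~ (c *: g + h)) v) => k.
- exact/subspace_green/Hlin.
- by apply: Hlin; exact: subspace_green.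
rewrite convolve_is_linear !convolve_green//; last exact: Hlin.
by case: eqP => // _; rewrite scaler0 addr0.
Qed.

Lemma green0 n : green n 0 = 0.
Proof.
have := green_is_linear n 1 H0 H0; rewrite !scale1r addr0 => /esym/eqP.
by rewrite -subr_eq0 addrK => /eqP.
Qed.

Lemma green_sum n m (f : 'I_m -> X) : (forall i, H (f i)) ->
  green n (\sum_(i < m) f i) = \sum_(i < m) green n (f i).
Proof.
elim: m f => [|m IH] f Hf; first by rewrite !big_ord0 green0.
rewrite !big_ord_recr/= -[X in green n (X + _)]scale1r green_is_linear//.
  by rewrite scale1r IH.
by apply: subspace_sum => i; exact: Hf.
Qed.

Lemma subspace_convolve_green g : (forall n, H (g n)) ->
  forall n, H (convolve green g n).
Proof. by move=> Hg n; apply: subspace_sum => t; exact: subspace_green. Qed.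

Lemma convolveK g n : (forall k, H (g k)) ->
  convolve A (convolve green g) n = g n.
Proof.
move=> Hg; rewrite /convolve.
under eq_bigr do rewrite linear_sum.
rewrite (sum_triangle (fun i j k => A i (green j (g k)))).
under eq_bigr => k _ do
  rewrite -/(convolve A (green^~ (g (n - k)%N)) k) convolve_green//.
by rewrite big_ord_recl/= subn0 big1 ?addr0.
Qed.

(** A right inverse of an injective operator is also a left inverse. *)
Lemma green_convolveK v n : (forall k, H (v k)) ->
  convolve green (convolve A v) n = v n.
Proof.
move=> Hv; have HAv := subspace_convolve Hv.
apply: (@convolve_inj (convolve green (convolve A v))) => // k.
  exact: subspace_convolve_green.
exact: convolveK.
Qed.

(** In terms of power series, [(G C) W = G (C W)]. *)
Lemma green_convolveA (Y : Type) (C : nat -> Y -> X) (W : nat -> Y) n :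
  (forall k l, H (C k (W l))) ->
  \sum_(m < n.+1) convolve green (C^~ (W (n - m)%N)) m =
  convolve green (fun k => \sum_(t < k.+1) C t (W (k - t)%N)) n.
Proof.
move=> HC; rewrite /convolve.
under [RHS]eq_bigr do rewrite green_sum//.
by rewrite (sum_triangle (fun i j k => green i (C j (W k)))).
Qed.

End Convolution.

(** * Cutoffs, translations and the operators of the scheme *)

Lemma l2normsq_reindex_le (R : realType) (I J : choiceType) (e : J -> I)
    (u : I -> R[i]) : injective e ->
  (l2normsq modc (u \o e) <= l2normsq modc u)%E.
Proof.
move=> inj_e.
rewrite /l2normsq -(esum_image setT e (fun i => (modc (u i) ^+ 2)%:E)).
  rewrite esum_mkcond; apply: le_esum => i _.
  by case: ifP => // _; rewrite lee_fin sqr_ge0.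
by move=> x y _ _; exact: inj_e.
Qed.

Lemma finite_box (d : nat) (r p : 'I_d -> nat) : finite_set (box r p).
Proof.
pose M := (\sum_k (r k + p k)).+1.
pose g (f : {ffun 'I_d -> 'I_M}) : zvec d :=
  [ffun k => (f k : nat)%:Z - (r k)%:Z].
apply: (@sub_finite_set _ _ (g @` setT)); last exact/finite_image/finite_finset.
move=> l lb; exists [ffun k => inord `|(l k + (r k)%:Z)%R|%N] => //.
apply/ffunP => k; rewrite !ffunE inordK; have /andP[lo hi] := lb k.
  by rewrite gez0_abs ?addrK// -lerBlDr sub0r.
have rpM : (r k + p k < M)%N by rewrite ltnS (bigD1 k)//= leq_addr.
by apply: leq_ltn_trans rpM; lia.
Qed.

Section Zvec.
Variable m : nat.

Definition ztail (j : zvec m.+1) : zvec m := [ffun k => j (lift ord0 k)].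

Lemma zcons_head x (j : zvec m) : zcons x j ord0 = x.
Proof. by rewrite ffunE /vcons unlift_none. Qed.

Lemma zcons_tail x (j : zvec m) : ztail (zcons x j) = j.
Proof. by apply/ffunP => k; rewrite !ffunE /vcons liftK. Qed.

Lemma zconsK (j : zvec m.+1) : zcons (j ord0) (ztail j) = j.
Proof.
apply/ffunP => k; rewrite !ffunE /vcons.
by case: unliftP => [k'|] ->; rewrite ?ffunE.
Qed.

Lemma zcons_add x y (j k : zvec m) :
  zcons x j + zcons y k = zcons (x + y) (j + k).
Proof.
apply/ffunP => i; rewrite !ffunE /vcons.
by case: unlift => [k'|]; rewrite ?ffunE.
Qed.

End Zvec.

Section Restriction.
Context {R : realType} {m : nat}.

Definition cutoff (P : pred int) (u : zvec m.+1 -> R[i]) : zvec m.+1 -> R[i] :=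
  fun j => if P (j ord0) then u j else 0.

Lemma cutoff_is_linear P : linear (cutoff P).
Proof.
move=> c u v; apply/funext => j; rewrite /cutoff !fctE.
by case: ifP => // _; rewrite scaler0 addr0.
Qed.

HB.instance Definition _ P := GRing.isLinear.Build R[i] (zvec m.+1 -> R[i])
  (zvec m.+1 -> R[i]) *:%R (cutoff P) (cutoff_is_linear P).

Lemma l2normsq_cutoff_le P u :
  (l2normsq modc (cutoff P u) <= l2normsq modc u)%E.
Proof.
apply: l2normsq_le => j; rewrite /cutoff.
by case: ifP; rewrite // modc0 modc_ge0.
Qed.

Lemma l2_cutoff P u : l2 modc u -> l2 modc (cutoff P u).
Proof. exact/le_lt_trans/l2normsq_cutoff_le. Qed.

Definition translate (l : zvec m.+1) (u : zvec m.+1 -> R[i]) :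
  zvec m.+1 -> R[i] := fun j => u (j + l).

Lemma l2normsq_translate_le l u :
  (l2normsq modc (translate l u) <= l2normsq modc u)%E.
Proof. by apply: (@l2normsq_reindex_le _ _ _ (+%R^~ l)); exact: addIr. Qed.

Lemma l2_translate l u : l2 modc u -> l2 modc (translate l u).
Proof. exact/le_lt_trans/l2normsq_translate_le. Qed.

End Restriction.

Section Lags.
Context {R : realType} {d' : nat}.
Local Notation d := d'.+1.
Variables (s : nat) (r p : 'I_d -> nat) (a : nat -> zvec d -> R[i]).

Lemma QE sigma u :
  Q r p a sigma u =
  \sum_(l <- finmap.enum_fset (fset_set (box r p))) a sigma l *: translate l u.
Proof.
by apply/funext => j; rewrite /Q fsbig_finite ?fct_sumE//; exact: finite_box.
Qed.

Lemma Q_is_linear sigma : linear (Q r p a sigma).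
Proof.
move=> c u v; rewrite !QE scaler_sumr -big_split/=; apply: eq_bigr => l _.
by apply/funext => j; rewrite !fctE /translate scalerDr !scalerA mulrC.
Qed.

HB.instance Definition _ sigma := GRing.isLinear.Build R[i] (zvec d -> R[i])
  (zvec d -> R[i]) *:%R (Q r p a sigma) (Q_is_linear sigma).

(** [Q] only sees the values of its argument on the stencil; every gluing
    argument rests on this. *)
Lemma Q_local sigma u v j :
  (forall l, box r p l -> u (j + l) = v (j + l)) ->
  Q r p a sigma u j = Q r p a sigma v j.
Proof. by move=> uv; apply: eq_fsbigr => l /set_mem/uv ->. Qed.

Lemma Q_translate sigma l u :
  Q r p a sigma (translate l u) = translate l (Q r p a sigma u).
Proof.
by apply/funext => j; apply: eq_fsbigr => k _; rewrite /translate addrAC.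
Qed.

Lemma Q_dominated sigma :
  exists2 M : R, 0 <= M & l2dominated modc (Q r p a sigma) M.
Proof.
pose L : seq (zvec d) := finmap.enum_fset (fset_set (box r p)).
pose M := 2 ^+ size L * \sum_(l <- L) modc (a sigma l) ^+ 2.
have M0 : 0 <= M.
  by rewrite mulr_ge0// ?exprn_ge0// sumr_ge0// => l _; exact: sqr_ge0.
exists M => // u _; rewrite QE -/L big_tnth.
apply: le_trans (l2normsq_sum_le _) _.
rewrite EFinM -muleA lee_wpmul2l ?lee_fin ?exprn_ge0//.
rewrite [in leRHS]big_tnth -sumEFin ge0_sume_distrl; last first.
  by move=> i _; rewrite lee_fin sqr_ge0.
apply: lee_sum => i _; apply: le_trans (l2normsqZ_le _ _) _.
by rewrite lee_wpmul2l ?l2normsq_translate_le// lee_fin sqr_ge0.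
Qed.

(** The coefficient of [z^(s+1-t)] in [sum_sigma z^sigma Q_sigma]: divided by
    [z^(s+1)], this polynomial becomes a power series in [1/z]. *)
Definition lag t (u : zvec d -> R[i]) : zvec d -> R[i] :=
  if (t <= s.+1)%N then Q r p a (s.+1 - t) u else 0.

Lemma lag_is_linear t : linear (lag t).
Proof.
move=> c u v; rewrite /lag; case: ifP => _; first exact: Q_is_linear.
by rewrite scaler0 addr0.
Qed.

HB.instance Definition _ t := GRing.isLinear.Build R[i] (zvec d -> R[i])
  (zvec d -> R[i]) *:%R (lag t) (lag_is_linear t).

Lemma lag0 : lag 0 = Q r p a s.+1.
Proof. by []. Qed.

Lemma lag_local t u v j :
  (forall l, box r p l -> u (j + l) = v (j + l)) -> lag t u j = lag t v j.
Proof. by rewrite /lag; case: ifP => // _; exact: Q_local. Qed.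

Lemma lag_translate t l u : lag t (translate l u) = translate l (lag t u).
Proof. by rewrite /lag; case: ifP => // _; exact: Q_translate. Qed.

Lemma lag_dominated :
  exists2 M : R, 0 <= M & forall t, l2dominated modc (lag t) M.
Proof.
pose M sigma := sval (cid2 (Q_dominated sigma)).
have M0 sigma : 0 <= M sigma by rewrite /M; case: cid2.
have QM sigma : l2dominated modc (Q r p a sigma) (M sigma).
  by rewrite /M; case: cid2.
exists (\sum_(sigma < s.+2) M sigma); first exact: sumr_ge0.
move=> t u u2; rewrite /lag; case: ifP => [ts|_]; last first.
  by rewrite l2normsq0 mule_ge0 ?l2normsq_ge0// lee_fin sumr_ge0.
apply: le_trans (QM _ _ u2) _; rewrite lee_wpmul2r ?l2normsq_ge0// lee_fin.
have lt_t : (s.+1 - t < s.+2)%N by rewrite ltnS leq_subr.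
by rewrite (bigD1 (Ordinal lt_t))//= lerDl sumr_ge0.
Qed.

Lemma l2_lag t u : l2 modc u -> l2 modc (lag t u).
Proof.
have [M M0 lagM] := lag_dominated; exact: (l2dominated_l2 M0 (lagM t)).
Qed.

Lemma convolve_local (u v : nat -> zvec d -> R[i]) n j :
  (forall k l, box r p l -> u k (j + l) = v k (j + l)) ->
  convolve lag u n j = convolve lag v n j.
Proof.
move=> uv; rewrite /convolve !fct_sumE; apply: eq_bigr => t _.
by apply: lag_local => l; exact: uv.
Qed.

Lemma convolve_translate l (u : nat -> zvec d -> R[i]) n :
  convolve lag (fun k => translate l (u k)) n = translate l (convolve lag u n).
Proof.
apply/funext => j; rewrite /translate /convolve !fct_sumE.
apply: eq_bigr => t _.
by rewrite lag_translate.
Qed.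

End Lags.

(** * Traces on the strip and the Calderon projector *)

Section Strip.
Context {R : realType} {d' : nat}.
Local Notation d := d'.+1.
Variables (r p : 'I_d -> nat).
Local Notation k := (p ord0 + r ord0)%N.
Local Notation X := (zvec d -> R[i]).
Local Notation W := (zvec d' -> 'cV[R[i]]_k).

Definition strip : pred int := [pred x | - (r ord0)%:Z < x <= (p ord0)%:Z].

Definition trace (u : X) : W := boundary_vector r p u 0.

(** Extension by zero: at most one index [i] satisfies the condition. *)
Definition ext (w : W) : X := fun j =>
  \sum_(i < k | j ord0 == (p ord0)%:Z - (i : nat)%:Z) w (ztail j) i 0.

Lemma traceE u j' i :
  trace u j' i 0 = u (zcons ((p ord0)%:Z - (i : nat)%:Z) j').
Proof. by rewrite /trace/boundary_vector mxE add0r. Qed.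

(** Reduces the boundary condition at [j1] to the one at [0]. *)
Lemma boundary_vector_translate u j1 :
  boundary_vector r p u j1 = trace (translate (zcons j1 0) u).
Proof.
apply/funext => j'; apply/matrixP => i o; rewrite ord1 traceE mxE.
by rewrite /translate zcons_add addr0 [in RHS]addrC addrA.
Qed.

Lemma trace_is_linear : linear trace.
Proof.
move=> c u v; apply/funext => j'; apply/matrixP => i o; rewrite ord1.
rewrite -[RHS]/((c *: trace u j' + trace v j') i 0) !mxE.
by rewrite -/(trace u j').
Qed.

HB.instance Definition _ := GRing.isLinear.Build R[i] X W *:%R trace
  trace_is_linear.

Lemma trace_sum n (u : 'I_n -> X) :
  trace (\sum_(i < n) u i) = \sum_(i < n) trace (u i).
Proof. exact: linear_sum. Qed.

Lemma ext_is_linear : linear ext.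
Proof.
move=> c v w; apply/funext => j; rewrite /ext !fctE scaler_sumr -big_split/=.
by apply: eq_bigr => i _; rewrite !mxE.
Qed.

HB.instance Definition _ := GRing.isLinear.Build R[i] W X *:%R ext
  ext_is_linear.

Lemma ext_out (w : W) (j : zvec d) : ~~ strip (j ord0) -> ext w j = 0.
Proof.
move=> out; rewrite /ext big_pred0// => i; apply: contraNF out => /eqP ->.
by rewrite /strip /=; have := ltn_ord i; lia.
Qed.

Lemma ext_in (w : W) (i : 'I_k) j' :
  ext w (zcons ((p ord0)%:Z - (i : nat)%:Z) j') = w j' i 0.
Proof.
rewrite /ext zcons_head zcons_tail (big_pred1 i)// => i'.
by rewrite /= (inj_eq (addrI _)) eqr_opp eqz_nat eq_sym.
Qed.

Lemma strip_index x :
  strip x -> exists i : 'I_k, x = (p ord0)%:Z - (i : nat)%:Z.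
Proof.
rewrite /strip/= => sx; have lt_i : (`|(p ord0)%:Z - x|%N < k)%N by lia.
by exists (Ordinal lt_i) => /=; lia.
Qed.

Lemma ext_trace u : ext (trace u) = cutoff strip u.
Proof.
apply/funext => j; rewrite /cutoff; case: ifPn => [sj|]; last exact: ext_out.
have [i ji] := strip_index sj.
by rewrite -[j in LHS]zconsK -[j in RHS]zconsK ji ext_in traceE.
Qed.

Lemma trace_cutoff (P : pred int) u : (forall x, strip x -> P x) ->
  trace (cutoff P u) = trace u.
Proof.
move=> sP; apply/funext => j'; apply/matrixP => i o; rewrite ord1 !traceE.
by rewrite /cutoff zcons_head sP// /strip/=; have := ltn_ord i; lia.
Qed.

Lemma euclnorm0 n : euclnorm (0 : 'cV[R[i]]_n) = 0.
Proof.
by rewrite /euclnorm big1 ?sqrtr0// => i _; rewrite mxE modc0 expr0n.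
Qed.

Lemma l2normsq_euclnorm (w : W) : l2normsq euclnorm w =
  (\sum_(i < k) l2normsq modc (fun j' => w j' i 0%R))%E.
Proof.
rewrite /l2normsq -esum_sum => [|j i _ _]; last by rewrite lee_fin sqr_ge0.
apply: eq_esum => j' _; rewrite sqr_sqrtr ?sumEFin// sumr_ge0// => i _.
exact: sqr_ge0.
Qed.

(** Summing slice by slice: on the slice [j_1 = p_1 - i], which is a copy of
    [zvec d'], the extension is the component of index [i]. *)
Lemma l2normsq_ext (w : W) : l2normsq modc (ext w) = l2normsq euclnorm w.
Proof.
pose slice (i : 'I_k) (j : zvec d) :=
  if j ord0 == (p ord0)%:Z - (i : nat)%:Z then (modc (w (ztail j) i 0) ^+ 2)%:E
  else 0%E.
have slice_ge0 i j : (0 <= slice i j)%E.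
  by rewrite /slice; case: ifP; rewrite // lee_fin sqr_ge0.
have -> : l2normsq modc (ext w) = (\sum_(i < k) \esum_(j in setT) slice i j)%E.
  rewrite /l2normsq -esum_sum//; apply: eq_esum => j _.
  have [/strip_index[i ji]|out] := boolP (strip (j ord0)).
    rewrite (bigD1 i)//= /slice ji eqxx big1 ?adde0 => [|i' i'i]; last first.
      by rewrite (inj_eq (addrI _)) eqr_opp eqz_nat eq_sym val_eqE (negbTE i'i).
    by rewrite -[j in ext w j]zconsK ji ext_in.
  rewrite ext_out// modc0 expr0n big1// => i _; rewrite /slice.
  case: eqP => // ji; case/negP: out; rewrite ji /strip/=.
  by have := ltn_ord i; lia.
rewrite l2normsq_euclnorm; apply: eq_bigr => i _.
pose e := @zcons d' ((p ord0)%:Z - (i : nat)%:Z).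
transitivity (\esum_(j in range e) slice i j)%E.
  rewrite [RHS]esum_mkcond; apply: eq_esum => j _; case: ifPn => // /negP je.
  rewrite /slice; case: eqP => // ji; case: je; apply/mem_set.
  by exists (ztail j) => //; rewrite /e -ji zconsK.
rewrite esum_image => [|x y _ _ /(congr1 (@ztail _))]; last first.
  by rewrite !zcons_tail.
by apply: eq_esum => j' _; rewrite /slice zcons_head zcons_tail eqxx.
Qed.

Lemma l2_ext (w : W) : l2 euclnorm w -> l2 modc (ext w).
Proof. by rewrite /l2/= l2normsq_ext. Qed.

(** Extension by zero is an isometry and turns the trace into a cutoff. *)
Lemma l2normsq_trace_le u : (l2normsq euclnorm (trace u) <= l2normsq modc u)%E.
Proof. by rewrite -l2normsq_ext ext_trace l2normsq_cutoff_le. Qed.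

Lemma l2_trace u : l2 modc u -> l2 euclnorm (trace u).
Proof. exact/le_lt_trans/l2normsq_trace_le. Qed.

End Strip.

Arguments ext {R d'} r p w.

Section Calderon.
Context {R : realType} {d' : nat}.
Local Notation d := d'.+1.
Variables (s : nat) (r p : 'I_d -> nat) (a : nat -> zvec d -> R[i]).
Local Notation k := (p ord0 + r ord0)%N.
Local Notation X := (zvec d -> R[i]).
Local Notation W := (zvec d' -> 'cV[R[i]]_k).
Local Notation A := (lag s r p a).
Local Notation trace := (trace r p).
Local Notation ext := (ext r p).

Variable S : X -> X.
Hypothesis S2 : forall u, l2 modc u -> l2 modc (S u).
Hypothesis SK : forall u, l2 modc u -> S (A 0 u) = u.
Hypothesis AK : forall u, l2 modc u -> A 0 (S u) = u.

Let H0 : l2 modc (0 : X) := l2_zero.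
Let Hlin := @l2_scale_add R (zvec d).
Let HA := @l2_lag R d' s r p a.

Definition left_half : pred int := [pred x | x <= 0].

Definition green_op : nat -> X -> X :=
  green (fun t => lag s r p a t : {linear X -> X}) S.

Definition source (t : nat) (w : W) : X := cutoff left_half (A t (ext w)).

(** The coefficient of [z^-n] in [trace G(z) 1_- A(z) ext]. *)
Definition calderon (n : nat) (w : W) : W :=
  trace (convolve green_op (source^~ w) n).

Lemma l2_source t w : l2 euclnorm w -> l2 modc (source t w).
Proof. by move=> w2; apply/l2_cutoff/HA/l2_ext. Qed.

(** [Pi(z)] applied to a power series of boundary data instead of a constant
    keeps the form [trace G(z) 1_- A(z) ext]. *)
Lemma convolve_calderon (w : nat -> W) n : (forall m, l2 euclnorm (w m)) ->
  \sum_(m < n.+1) calderon m (w (n - m)%N) =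
  trace (convolve green_op
    (fun m => cutoff left_half (convolve A (fun l => ext (w l)) m)) n).
Proof.
move=> w2; rewrite /calderon -trace_sum /green_op.
rewrite (green_convolveA H0 Hlin HA S2 SK AK); last first.
  by move=> *; exact: l2_source.
congr (trace (convolve _ _ _)); apply/funext => m.
by rewrite /convolve linear_sum.
Qed.

(** The sequence [v] cut off to [j_1 > -r_1] solves the equation that defines the
    projector: on the right its stencils see [v], and on the left they see the
    extension by zero of the trace of [v]. *)
Lemma calderon_fix (v : nat -> X) n : (forall m, l2 modc (v m)) ->
  (forall m (j : zvec d), 0 < j ord0 -> convolve A v m j = 0) ->
  \sum_(m < n.+1) calderon m (trace (v (n - m)%N)) = trace (v n).
Proof.
move=> v2 Av0; pose P := [pred x : int | - (r ord0)%:Z < x].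
pose vr m := cutoff P (v m).
have vr2 m : l2 modc (vr m) by exact: l2_cutoff.
rewrite (convolve_calderon (w := fun m => trace (v m))); last first.
  by move=> m; exact: l2_trace.
rewrite -[RHS](trace_cutoff (P := P)); last by move=> x /andP[].
rewrite -/(vr n) -(green_convolveK H0 Hlin HA S2 SK AK n vr2).
congr (trace (convolve _ _ _)); apply/funext => m; apply/funext => j.
rewrite /cutoff /left_half/=; case: ifP => j0.
  apply: convolve_local => t l lb.
  rewrite ext_trace /vr /cutoff !ffunE /strip /P/=.
  suff -> : j ord0 + l ord0 <= (p ord0)%:Z by rewrite andbT.
  by have := lb ord0; lia.
rewrite -[LHS](Av0 m j) ?ltNge ?j0//; apply: convolve_local => t l lb.
rewrite /vr /cutoff !ffunE /P/=.
suff -> : - (r ord0)%:Z < j ord0 + l ord0 by [].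
by have := lb ord0; lia.
Qed.

(** The solution of the equation that defines the projector is now the difference
    between the extension by zero of the trace of [v] and [v] cut off to
    [j_1 <= p_1]; these two have the same trace. *)
Lemma calderon_kill (v : nat -> X) n : (forall m, l2 modc (v m)) ->
  (forall m (j : zvec d), j ord0 <= 0 -> convolve A v m j = 0) ->
  \sum_(m < n.+1) calderon m (trace (v (n - m)%N)) = 0.
Proof.
move=> v2 Av0; pose P := [pred x : int | x <= (p ord0)%:Z].
pose vl m := cutoff P (v m).
have vl2 m : l2 modc (vl m) by exact: l2_cutoff.
pose e m := ext (trace (v m)).
have e2 m : l2 modc (e m) by apply/l2_ext/l2_trace.
have el2 m : l2 modc (e m - vl m).
  by rewrite -[- _]scaleN1r addrC; exact: Hlin.
rewrite (convolve_calderon (w := fun m => trace (v m))); last first.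
  by move=> m; exact: l2_trace.
rewrite -[RHS](subrr (trace (v n))).
rewrite -[X in _ = X - _](trace_cutoff (P := strip r p))//.
rewrite -[X in _ = _ - X](trace_cutoff (P := P)); last by move=> x /andP[].
rewrite -ext_trace -/(e n) -/(vl n) -linearB.
rewrite -(green_convolveK H0 Hlin HA S2 SK AK n el2).
congr (trace (convolve _ _ _)); apply/funext => m; apply/funext => j.
rewrite (convolveB _ e vl) !fctE -/(e _) /cutoff /left_half/=; case: ifP => j0.
  rewrite -[LHS]subr0; congr (_ - _); rewrite -(Av0 m j j0).
  apply: convolve_local => t l lb; rewrite /vl /cutoff !ffunE /P/=.
  suff -> : j ord0 + l ord0 <= (p ord0)%:Z by [].
  by have := lb ord0; lia.
apply/esym/eqP; rewrite subr_eq0; apply/eqP; apply: convolve_local => t l lb.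
rewrite /e ext_trace /vl /cutoff !ffunE /strip /P/=.
suff -> : - (r ord0)%:Z < j ord0 + l ord0 by [].
by have := lb ord0; lia.
Qed.

(** [Pi(z) w] is itself the trace of a sequence that solves the scheme on the
    right, namely [G(z) 1_- A(z) ext w]. *)
Lemma calderon_idem n w : l2 euclnorm w ->
  \sum_(m < n.+1) calderon m (calderon (n - m) w) = calderon n w.
Proof.
move=> w2; apply: (calderon_fix (v := convolve green_op (source^~ w))) => m.
  apply: (subspace_convolve_green H0 Hlin HA S2) => t; exact: l2_source.
move=> j j0; rewrite (convolveK H0 Hlin HA S2 AK).
  by rewrite /source /cutoff /left_half/= leNgt j0.
by move=> t; exact: l2_source.
Qed.

Lemma calderon_is_linear n c v w : l2 euclnorm v -> l2 euclnorm w ->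
  calderon n (c *: v + w) = c *: calderon n v + calderon n w.
Proof.
move=> v2 w2; rewrite /calderon -(trace_is_linear r p c); congr trace.
rewrite /convolve scaler_sumr -big_split/=; apply: eq_bigr => t _.
rewrite /green_op /source !linearP.
by rewrite (green_is_linear H0 Hlin HA S2 SK AK)//; exact: l2_source.
Qed.

(** When [Q_{s+1}] is the identity, [Pi_0] reduces to [trace 1_- ext], and the
    component of index [i] lives at [j_1 = p_1 - i], which is [<= 0] exactly for
    the last [r_1] components. *)
Lemma calderon_explicit w : Q r p a s.+1 = id -> l2 euclnorm w ->
  calderon 0 w = fun j' => (block_mx 0 0 0 1%:M : 'M[R[i]]_k) *m w j'.
Proof.
move=> Qid w2; have A0 u : A 0 u = u by rewrite lag0 Qid.
rewrite /calderon /convolve big_ord1 subn0.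
have -> : green_op 0 (source 0 w) = source 0 w.
  by rewrite -[RHS]SK ?A0//; exact: l2_source.
apply/funext => j'; apply/matrixP => i o; rewrite ord1 traceE /source A0.
rewrite /cutoff zcons_head ext_in /left_half/=.
rewrite -[w j']vsubmxK mul_block_col !mul0mx !add0r mul1mx.
rewrite [in RHS]mxE; case: splitP => i' ii'.
  by rewrite ifF ?mxE//; apply/negbTE; rewrite -ltNge subr_gt0 ltz_nat ii'.
have -> : i = rshift (p ord0) i' by exact: val_inj.
by rewrite col_mxEd ifT// subr_le0 lez_nat leq_addr.
Qed.

End Calderon.

Arguments source {R d'} s r p a t w.
Arguments l2_source {R d'} s r p a t [w].
Arguments calderon {R d'} s r p a S n w.

(** * Bounds from stability *)

Lemma sum_ord_support (V : nmodType) (F : nat -> V) m n :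
  (forall t, (m <= t < n)%N -> F t = 0) ->
  \sum_(t < n) F t = \sum_(t < m) if (t < n)%N then F t else 0.
Proof.
move=> F0; rewrite -big_mkcond/=.
rewrite (big_ord_widen_cond (m + n) (fun t => t < n)%N) ?leq_addr//.
rewrite (big_ord_widen_cond (m + n) xpredT F) ?leq_addl//=.
rewrite (bigID (fun t : 'I_(m + n) => t < m)%N)/= [X in _ + X]big1 ?addr0//.
by move=> t /andP[lt_n]; rewrite -leqNgt => le_t; rewrite F0 ?le_t.
Qed.

Lemma geometric_nneseries_lty (R : realType) (delta K : R) (c : nat -> \bar R) :
  0 < delta -> (forall n, 0 <= c n <= K%:E)%E ->
  (\sum_(0 <= n <oo) (((1 + delta) ^+ n)^-1)%:E * c n < +oo)%E.
Proof.
move=> d0 cK; pose q := (1 + delta)^-1.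
have q0 : 0 < q by rewrite invr_gt0 addr_gt0.
have q1 : q < 1 by rewrite invf_lt1 ?addr_gt0// ltrDl.
have K0 : 0 <= K by have /andP[c0] := cK 0%N; rewrite -lee_fin; exact: le_trans.
have term_ge0 n : (0 <= (((1 + delta) ^+ n)^-1)%:E * c n)%E.
  have /andP[c0 _] := cK n.
  by rewrite mule_ge0// lee_fin invr_ge0 exprn_ge0 ?addr_ge0// ltW.
apply: (@le_lt_trans _ _ ((1 - q)^-1 * K)%:E); last exact: ltry.
apply: lime_le; first by apply: is_cvg_nneseries => n _ _; exact: term_ge0.
apply: nearW => n; apply: (@le_trans _ _ (\sum_(0 <= k < n) (q ^+ k * K)%:E)%E).
  apply: lee_sum => k _; have /andP[c0 cK'] := cK k.
  rewrite EFinM /q exprVn lee_wpmul2l//.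
  by rewrite lee_fin invr_ge0 exprn_ge0 ?addr_ge0// ltW.
rewrite sumEFin lee_fin -mulr_suml ler_wpM2r// big_mkord.
rewrite -[leRHS]div1r ler_pdivlMr ?subr_gt0// mulrC.
by rewrite -opprB mulNr -subrX1 opprB lerBlDr lerDl exprn_ge0// ltW.
Qed.

Section Bounds.
Context {R : realType} {d' : nat}.
Local Notation d := d'.+1.
Variables (s : nat) (r p : 'I_d -> nat) (a : nat -> zvec d -> R[i]).
Local Notation X := (zvec d -> R[i]).
Local Notation A := (lag s r p a).

Lemma convolve_lag (u : nat -> X) n :
  convolve A u (n + s.+1) =
  \sum_(sigma < s.+2) Q r p a sigma (u (n + sigma)%N).
Proof.
rewrite /convolve.
rewrite (sum_ord_support (F := fun t => A t (u (n + s.+1 - t)%N)) (m := s.+2)).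
  rewrite (reindex_inj rev_ord_inj)/=; apply: eq_bigr => i _.
  have i_le : (i <= s.+1)%N by rewrite -ltnS.
  rewrite subSS ltnS (leq_trans (leq_subr _ _)) ?leq_addl//.
  by rewrite /lag leq_subr subKn// -addnBA ?leq_subr// subKn.
by move=> t /andP[lt_t _]; rewrite /lag leqNgt lt_t.
Qed.

(** From time [s + 1] on, the convolution is the left-hand side of the scheme; at
    earlier times only the initial data enter, and these vanish on the stencils
    centred at [j_1 <= 0]. *)
Lemma cauchy_left_half (f : 'I_s.+1 -> X) u n (j : zvec d) :
  (forall sigma (j1 : int) j',
    j1 <= (p ord0)%:Z -> f sigma (zcons j1 j') = 0) ->
  cauchy_solution r p a f u -> j ord0 <= 0 -> convolve A u n j = 0.
Proof.
move=> f0 [_ eq_u init] j0; have [lt_n|le_n] := ltnP n s.+1; last first.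
  by rewrite -(subnK le_n) convolve_lag eq_u.
have u0 m (l : zvec d) : (m <= n)%N -> l ord0 <= (p ord0)%:Z -> u m l = 0.
  move=> le_m l0; have lt_m : (m < s.+1)%N by exact: leq_ltn_trans le_m lt_n.
  by rewrite (init (Ordinal lt_m)) -[l]zconsK f0.
rewrite /convolve fct_sumE big1// => t _.
rewrite (@lag_local _ _ s r p a t _ 0) ?linear0// => l lb.
rewrite u0 ?leq_subr// ffunE; have /andP[_ lp] := lb ord0.
by rewrite -[leRHS]add0r lerD.
Qed.

Variable S : X -> X.
Hypothesis S2 : forall u, l2 modc u -> l2 modc (S u).
Hypothesis SK : forall u, l2 modc u -> S (A 0 u) = u.
Hypothesis AK : forall u, l2 modc u -> A 0 (S u) = u.

Let H0 : l2 modc (0 : X) := l2_zero.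
Let Hlin := @l2_scale_add R (zvec d).
Let HA := @l2_lag R d' s r p a.

(** The sequence [G_n g], delayed by [s] steps, is the solution of the Cauchy
    problem with data [(0, .., 0, S g)]: its convolution with [A] only fails to
    vanish at time [0], where the scheme imposes nothing. *)
Lemma green_dominated (Dx : 'I_d -> R) (MS : R) :
  (forall i, 0 < Dx i) -> stability s r p a Dx ->
  0 <= MS -> l2dominated modc S MS ->
  exists2 M : R, 0 <= M &
    forall n, l2dominated modc (green_op s r p a S n) M.
Proof.
move=> Dx_gt0 [C C_gt0 stab] MS0 SM.
exists (C * MS) => [|n g g2]; first by rewrite mulr_ge0// ltW.
pose G m := green_op s r p a S m g.
have G2 m : l2 modc (G m) by exact: (subspace_green H0 Hlin HA S2).
pose u m := if (m < s)%N then 0 else G (m - s)%N.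
pose f (sigma : 'I_s.+1) := u sigma.
have u2 m : l2 modc (u m) by rewrite /u; case: ifP => // _; exact: l2_zero.
have u_sol : cauchy_solution r p a f u.
  split=> // m; rewrite -convolve_lag /convolve.
  rewrite (sum_ord_support (F := fun t => A t (u (m + s.+1 - t)%N)) (m := m.+2)).
    rewrite -[RHS](convolve_green H0 Hlin HA S2 AK m.+1 g2).
    apply: eq_bigr => t _; have t_le : (t <= m.+1)%N by rewrite -ltnS.
    have -> : (m + s.+1 - t = m.+1 - t + s)%N by lia.
    have -> : u (m.+1 - t + s)%N = G (m.+1 - t)%N.
      by rewrite /u ltnNge leq_addl addnK.
    by rewrite ifT; last by lia.
  by move=> t /andP[lt_t t_lt]; rewrite /u ifT ?linear0//; lia.
have le_sup := stab f (fun sigma => u2 sigma) u u_sol.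
have : (tnormsq Dx (u (n + s)%N) <=
    C%:E * \sum_(sigma < s.+1) tnormsq Dx (f sigma))%E.
  by apply: le_trans le_sup; apply: ereal_sup_ubound; exists (n + s)%N.
have -> : u (n + s)%N = G n by rewrite /u ltnNge leq_addl addnK.
rewrite big_ord_recr/= big1 => [|i _]; last first.
  by rewrite /f/= /u ltn_ord /tnormsq l2normsq0 mule0.
rewrite add0e /f/= /u ltnn subnn /tnormsq muleCA.
rewrite lee_pmul2l//; last by rewrite lte_fin prodr_gt0.
move=> le_G; apply: le_trans le_G _.
by rewrite EFinM -muleA lee_wpmul2l ?SM// lee_fin ltW.
Qed.

(** As [A_t = 0] for [t > s + 1], at most [s + 2] terms of the convolution that
    defines [Pi_n] are nonzero, whatever [n]. *)
Lemma calderon_dominated (MG : R) : 0 <= MG ->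
  (forall n, l2dominated modc (green_op s r p a S n) MG) ->
  exists2 M : R, 0 <= M &
    forall n, l2dominated euclnorm (calderon s r p a S n) M.
Proof.
move=> MG0 GM; have [MA MA0 AM] := lag_dominated s r p a.
exists (2 ^+ s.+2 * (s.+2%:R * (MG * MA))) => [|n w w2].
  by apply: mulr_ge0; [exact: exprn_ge0|apply: mulr_ge0 => //; exact: mulr_ge0].
have src2 t := l2_source s r p a t w2.
pose F t := green_op s r p a S (n - t) (source s r p a t w).
have F_le t : (l2normsq modc (F t) <= (MG * MA)%:E * l2normsq euclnorm w)%E.
  rewrite /F; apply: le_trans (GM _ _ (src2 t)) _.
  rewrite EFinM -muleA lee_wpmul2l// (le_trans (l2normsq_cutoff_le _ _))//.
  by rewrite -(l2normsq_ext (r := r) (p := p)) AM//; exact: l2_ext.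
rewrite /calderon.
have -> : convolve (green_op s r p a S) (source s r p a ^~ w) n =
    \sum_(t < s.+2) if (t < n.+1)%N then F t else 0.
  rewrite -sum_ord_support => [|t /andP[lt_t _]]; last first.
    have src0 : source s r p a t w = 0.
      by rewrite /source /lag leqNgt lt_t linear0.
    by rewrite /F src0; exact: (green0 H0 Hlin HA S2 SK AK).
  rewrite /convolve (reindex_inj rev_ord_inj)/=; apply: eq_bigr => t _.
  by rewrite subSS subKn// -ltnS.
apply: le_trans (l2normsq_trace_le r p _) _.
apply: le_trans (l2normsq_sum_le _) _.
rewrite [in leRHS]EFinM -[leRHS]muleA lee_wpmul2l ?lee_fin ?exprn_ge0//.
have -> : ((s.+2%:R * (MG * MA))%:E * l2normsq euclnorm w =
    \sum_(t < s.+2) (1%:E * ((MG * MA)%:E * l2normsq euclnorm w)))%E.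
  rewrite -ge0_sume_distrl => [|i _]; last by rewrite lee_fin.
  by rewrite sumEFin sumr_const card_ord EFinM muleA.
apply: lee_sum => t _; rewrite mul1e; case: ifP => _; first exact: F_le.
rewrite l2normsq0; apply: mule_ge0; last exact: l2normsq_ge0.
by rewrite lee_fin; exact: mulr_ge0.
Qed.

End Bounds.

(** * Transparent boundary conditions *)

Theorem theorem1 (R : realType) (d' s : nat) (r p : 'I_d'.+1 -> nat)
    (Delta : set (R * ('I_d'.+1 -> R)))
    (a : R * ('I_d'.+1 -> R) -> nat -> zvec d'.+1 -> R[i])
    (Delta_pos : forall D, Delta D -> 0 < D.1 /\ forall k, 0 < D.2 k)
    (A0 : forall D, Delta D -> solvability s r p (a D))
    (A1 : forall D, Delta D -> stability s r p (a D) D.2)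
    (A2 : forall D, Delta D -> noncharacteristic s r p (a D))
    (A3 : forall D, Delta D -> technical_restriction s r p (a D)) :
  forall D, Delta D ->
  exists Pi : nat -> (zvec d' -> 'cV[R[i]]_(p ord0 + r ord0)) ->
              (zvec d' -> 'cV[R[i]]_(p ord0 + r ord0)),
    [/\ forall n, l2bounded euclnorm (Pi n),
        forall delta : R, 0 < delta ->
          (\sum_(0 <= n <oo) (((1 + delta) ^+ n)^-1)%:E *
             l2opnorm euclnorm (Pi n) < +oo)%E,
        forall n (w : zvec d' -> 'cV[R[i]]_(p ord0 + r ord0)), l2 euclnorm w ->
          Pi n w = \sum_(m < n.+1) Pi m (Pi (n - m)%N w),
        forall f : 'I_s.+1 -> zvec d'.+1 -> R[i],
          (forall sigma, l2 modc (f sigma)) ->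
          (forall sigma (j1 : int) j', j1 <= (p ord0)%:Z -> f sigma (zcons j1 j') = 0) ->
          forall u, cauchy_solution r p (a D) f u ->
          forall n (j1 : int), j1 <= 0 ->
            \sum_(m < n.+1) Pi (n - m)%N (boundary_vector r p (u m) j1) = 0
      & explicit_scheme s r p (a D) ->
        forall w : zvec d' -> 'cV[R[i]]_(p ord0 + r ord0), l2 euclnorm w ->
          Pi 0%N w = fun j' =>
            (block_mx 0 0 0 1%:M : 'M[R[i]]_(p ord0 + r ord0)) *m w j'].
Proof.
move=> D DD; have [_ Dx_gt0] := Delta_pos D DD.
have [[_ [S Sbounded QS]] _] := A0 D DD.
have [S2 _ _] := Sbounded.
have [MS MS0 SM] := l2bounded_dominated Sbounded.
have SK u : l2 modc u -> S (lag s r p (a D) 0 u) = u by move=> /QS[].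
have AK u : l2 modc u -> lag s r p (a D) 0 (S u) = u by move=> /QS[].
have [MG MG0 GM] := green_dominated S2 AK Dx_gt0 (A1 D DD) MS0 SM.
have [M M0 PiM] := calderon_dominated S2 SK AK MG0 GM.
pose Pi := calderon s r p (a D) S.
have norm_le n : (l2opnorm euclnorm (Pi n) <= (Num.sqrt M)%:E)%E.
  exact: l2opnorm_le.
exists Pi; split.
- move=> n; split.
  + exact: l2dominated_l2 M0 (PiM n).
  + by move=> c v w v2 w2; exact: calderon_is_linear.
  + exact: le_lt_trans (norm_le n) (ltry _).
- move=> delta delta_gt0.
  apply: (geometric_nneseries_lty (K := Num.sqrt M)) => // n; rewrite norm_le andbT.
  exact/l2opnorm_ge0/euclnorm0.
- by move=> n w w2; exact/esym/(calderon_idem S2 SK AK n w2).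
- move=> f f2 f0 u u_sol n j1 j1_le0; have [u2 _ _] := u_sol.
  pose e : zvec d'.+1 := zcons j1 0; pose v m := translate e (u m).
  rewrite (reindex_inj rev_ord_inj)/=.
  rewrite -[RHS](calderon_kill S2 SK AK (v := v) n).
  + apply: eq_bigr => m _; rewrite subSS subKn -1?ltnS//.
    by rewrite boundary_vector_translate.
  + by move=> m; exact: l2_translate.
  + move=> m j j_le0; rewrite convolve_translate.
    apply: (cauchy_left_half m f0 u_sol).
    by rewrite ffunE zcons_head -[leRHS]addr0 lerD.
- by move=> expl w w2; exact: (calderon_explicit SK expl w2).
Qed.
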